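(* For the submodule $M=[(z-w)^2]$ of $H^2(\mathbb D^2)$, \[ \Sigma_2(M)=\sum_{n=0}^\infty|\langle w^2\phi_n,z^2\psi_n\rangle|^2=\frac{178}{3}\pi^2-585. \]
   Context: $H^2(\mathbb D^2)$ is the Hardy space on the bidisk (monomials $z^aw^b$ orthonormal), $[q]$ the smallest closed subspace containing $q$ and invariant under multiplication by $z$ and $w$. Let $p=(z-w)^2$. For $n\ge0$ let $A^n=(a_{i,j})_{i,j=0}^n$ with $a_{i,j}=\langle pw^{|i-j|},pz^{|i-j|}\rangle$ (this is the symmetric pentadiagonal Toeplitz matrix with diagonal $6$, first off-diagonals $-4$, second off-diagonals $1$); $D_0=1$, $D_n=\det A^{n-1}$ ($n\ge1$); $A^n_{i,j}$ is the $(i,j)$ cofactor ($(-1)^{i+j}$ times the minor deleting row $i$ and column $j$). Define $\phi_0=\psi_0=p/\|p\|$ and for $n\ge1$ \[ \phi_n=\frac{\sum_{j=0}^n pA^n_{0,j}z^jw^{n-j}}{\sqrt{D_{n+1}D_n}},\qquad \psi_n=\frac{\sum_{j=0}^n pA^n_{n,j}z^jw^{n-j}}{\sqrt{D_{n+1}D_n}}; \] these form orthonormal bases of $M\ominus zM$ and $M\ominus wM$ respectively. For $k\ge0$, $\Sigma_k(M):=\sum_{n\ge0}|\langle w^k\phi_n,z^k\psi_n\rangle|^2$. *)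

(* Defs.v *)
From HB Require Import structures.
From mathcomp Require Import all_boot all_order all_algebra.
From mathcomp Require Import all_classical all_reals all_analysis.
Set Implicit Arguments. Unset Strict Implicit. Unset Printing Implicit Defensive.
Import Order.TTheory GRing.Theory Num.Theory.
Local Open Scope ring_scope.

(* Polynomials in two variables z, w with real coefficients are represented as
   P : {poly {poly R}}, P = \sum_b (\sum_a P`_b`_a z^a) w^b, i.e. the outer
   variable is w and the inner variable is z.  The coefficient of z^a w^b is P`_b`_a. *)
Section H2.
Variable R : realType.

Definition zP : {poly {poly R}} := ('X)%:P.
Definition wP : {poly {poly R}} := 'X.
Definition cstP (c : R) : {poly {poly R}} := (c%:P)%:P.

(* Hardy space H^2(D^2) inner product restricted to polynomials:
   the monomials z^a w^b are orthonormal (real coefficients, so no conjugation). *)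
Definition h2inner (P Q : {poly {poly R}}) : R :=
  \sum_(b < size P) \sum_(a < size P`_b) P`_b`_a * Q`_b`_a.

Definition h2norm (P : {poly {poly R}}) : R := Num.sqrt (h2inner P P).

Definition pP : {poly {poly R}} := (zP - wP) ^+ 2.

Definition Amat (n : nat) : 'M[R]_n.+1 :=
  \matrix_(i < n.+1, j < n.+1)
    h2inner (pP * wP ^+ (maxn i j - minn i j)) (pP * zP ^+ (maxn i j - minn i j)).

Definition Dn (n : nat) : R :=
  match n with 0 => 1 | m.+1 => \det (Amat m) end.

Definition phi (n : nat) : {poly {poly R}} :=
  if n is 0 then cstP (h2norm pP)^-1 * pP
  else cstP (Num.sqrt (Dn n.+1 * Dn n))^-1 *
       \sum_(j < n.+1) cstP (cofactor (Amat n) ord0 j) * (pP * zP ^+ j * wP ^+ (n - j)).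

Definition psi (n : nat) : {poly {poly R}} :=
  if n is 0 then cstP (h2norm pP)^-1 * pP
  else cstP (Num.sqrt (Dn n.+1 * Dn n))^-1 *
       \sum_(j < n.+1) cstP (cofactor (Amat n) ord_max j) * (pP * zP ^+ j * wP ^+ (n - j)).

Definition Sigma_term (k n : nat) : R :=
  `| h2inner (wP ^+ k * phi n) (zP ^+ k * psi n) | ^+ 2.

End H2.

(* Main.v *)
(* The first column of the inverse of the Toeplitz matrix A^n is explicit: fourth differences
   annihilate cubics, so it is given by a cubic polynomial in j whose zeros and normalization
   encode the boundary rows.  This yields the cofactors A^n_{0,j} = D_{n+1} f_n(j), by symmetry
   A^n_{n,j} = D_{n+1} f_n(n - j), and D_n = D_{n+1} f_n(0).  Pairing w^2 phi_n with z^2 psi_n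
   evaluates A f_n in the rows 2, ..., n+2, of which only the two rows n+1, n+2 beyond the matrix
   contribute, so
     <w^2 phi_n, z^2 psi_n> = -2 (n^2 + 5n - 2) / ((n+2)(n+3)(n+4)).
   By partial fractions in m = n + 3, the squares sum to 4 * 89 * zeta(2) - 585. *)
Require Import Defs.
From HB Require Import structures.
From mathcomp Require Import all_boot all_order all_algebra.
From mathcomp Require Import all_classical all_reals all_analysis.
From mathcomp Require Import zify ring lra.
Import Order.TTheory GRing.Theory Num.Theory.
Import numFieldNormedType.Exports.
Local Open Scope classical_set_scope.
Local Open Scope ring_scope.

(** * The Basel sum *)

Section Basel.
Context {R : realType}.
Implicit Types (x : R) (n k : nat).

Lemma sin_le x : 0 <= x -> sin x <= x.
Proof.
move=> x0; have := @MVT_segment R (@sin R) (@cos R) 0 x x0 _ _.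
case=> [|c _].
  by apply: continuous_subspaceT => y; exact: continuous_sin.
by rewrite sin0 !subr0 => ->; rewrite ler_piMl // cos_le1.
Qed.

Lemma le_tan x : 0 <= x < pi / 2 -> x <= tan x.
Proof.
case/andP=> x0 xpi.
have cgt0 y : 0 <= y <= x -> 0 < cos y.
  by move=> yx; apply: cos_gt0_pihalf; have := pi_gt0 R; lra.
have := @MVT_segment R (@tan R) (fun y => (cos y) ^- 2) 0 x x0 _ _.
case=> [y|/=|c].
- rewrite in_itv /= => /andP[y0 yx]; apply: is_derive_tan.
  by rewrite gt_eqF // cgt0 // !ltW.
- apply: continuous_in_subspaceT => y; rewrite inE /= in_itv /= => yx.
  by apply: continuous_tan; rewrite gt_eqF // cgt0.
rewrite in_itv /= tan0 !subr0 => cx ->; rewrite ler_peMl //.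
have c0 := cgt0 _ cx.
by rewrite invf_ge1 ?exprn_gt0 // expr_le1 ?ltW ?cos_le1 // ltW.
Qed.

(** * Squared cosecants and their sum over dyadic angles *)

Definition csc2 x : R := (sin x ^+ 2)^-1.

(** Both bounds come from sin x <= x <= tan x, since csc^2 x - 1 = cot^2 x. *)
Lemma csc2_bounds {x} : 0 < x < pi / 2 -> csc2 x - 1 <= (x ^+ 2)^-1 <= csc2 x.
Proof.
move=> xpi; have /andP[x0 _] := xpi.
have s0 : 0 < sin x by exact: sin_gt0_pihalf.
have c0 : 0 < cos x by apply: cos_gt0_pihalf; have := pi_gt0 R; lra.
have sx : sin x <= x by apply: sin_le; exact: ltW.
have xt : x <= tan x by apply: le_tan; lra.
apply/andP; split.
- rewrite (_ : csc2 x - 1 = (tan x ^+ 2)^-1); last first.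
    by rewrite /tan /csc2 expr_div_n invf_div cos2sin2; field; rewrite gt_eqF.
  have t0 : 0 < tan x by exact: lt_le_trans xt.
  by rewrite lef_pV2 ?posrE ?exprn_gt0 // lerXn2r ?nnegrE // ltW.
- by rewrite lef_pV2 ?posrE ?exprn_gt0 // lerXn2r ?nnegrE // ltW.
Qed.

(** With s = sin x and c = cos x, 1/s^2 + 1/c^2 = 1/(s c)^2, and s c is half of sin 2x. *)
Lemma csc2_double {x} : sin x != 0 -> cos x != 0 ->
  csc2 x + csc2 (pi / 2 - x) = 4 * csc2 (x *+ 2).
Proof.
move=> s0 c0; rewrite /csc2 sin_mulr2n sinB sin_pihalf cos_pihalf mul1r mul0r subr0.
have : cos x ^+ 2 + sin x ^+ 2 = 1 by exact: cos2Dsin2.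
move: (cos x) (sin x) s0 c0 => c s s0 c0 cs.
rewrite -[c *s *+ 2]mulr_natr !exprMn.
transitivity ((c ^+ 2 + s ^+ 2) / (s ^+ 2 * c ^+ 2)); first by field; rewrite s0 c0.
by rewrite cs; field; rewrite s0 c0.
Qed.

Lemma sum_nat_fold (V : nmodType) (F : nat -> V) m :
  \sum_(0 <= k < m + m) F k = \sum_(0 <= k < m) (F k + F (m + m - k.+1)%N).
Proof.
rewrite (@big_cat_nat _ _ _ m) ?leq_addr //= big_split; congr (_ + _).
rewrite big_nat_rev -{1}[m]add0n big_addn addnK.
by apply: eq_bigr => k _; congr F; lia.
Qed.

Lemma pow2_neq0 n : 2 ^+ n != 0 :> R.
Proof. by rewrite expf_neq0 // pnatr_eq0. Qed.

Definition odd_angle n k : R := (k.*2.+1)%:R * pi / (2 ^+ n.+2).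

Lemma odd_angle_bounds {n k} : (k < 2 ^ n)%N -> 0 < odd_angle n k < pi / 2.
Proof.
move=> kn; have pi0 := pi_gt0 R.
have p0 : 0 < 2 ^+ n.+2 :> R by rewrite exprn_gt0.
rewrite /odd_angle; apply/andP; split; first by rewrite divr_gt0 // mulr_gt0 // ltr0n.
rewrite ltr_pdivrMr //.
rewrite -mulrA [2^-1 * _]mulrC mulrA.
have -> : pi * 2 ^+ n.+2 / 2 = (2 ^ n.+1)%:R * pi :> R.
  by rewrite natrX exprS; field.
by rewrite ltr_pM2r // ltr_nat expnS; lia.
Qed.

(* Hofbauer's halving argument: the angles at level n+1 pair up as x and pi/2 - x,
   whose doubles are the angles at level n. *)
Lemma sum_csc2_odd_angle n :
  \sum_(0 <= k < 2 ^ n) csc2 (odd_angle n k) = 2 * 4 ^+ n.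
Proof.
elim: n => [|n IH].
  rewrite big_nat1 /odd_angle /= mul1r expr0 mulr1 /csc2.
  (* The only angle at level 0 is pi/4, its own mirror image, so doubling gives 2 csc^2(pi/4) = 4
     csc^2(pi/2) = 4. *)
  have := @csc2_double (pi / 4).
  rewrite /csc2 (_ : pi / 2 - pi / 4 = pi / 4); last by field.
  rewrite (_ : (pi / 4) *+ 2 = pi / 2 :> R); last by rewrite -mulr_natr; field.
  rewrite sin_pihalf (_ : 2 ^+ 2 = 4 :> R); last by ring.
  have pi0 := pi_gt0 R.
  rewrite !gt_eqF ?sin_gt0_pihalf ?cos_gt0_pihalf //; [|lra|lra].
  by move=> /(_ isT isT); rewrite expr1n invr1; lra.
rewrite expnS mul2n -addnn sum_nat_fold exprS mulrCA -IH mulr_sumr big_nat [RHS]big_nat.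
apply: eq_bigr => k /andP[_ kn].
have kb := odd_angle_bounds kn; have pi0 := pi_gt0 R.
have -> : odd_angle n k = odd_angle n.+1 k *+ 2.
  by rewrite /odd_angle [2 ^+ n.+3]exprS; move: (2 ^+ n.+2) (pow2_neq0 n.+2) => t t0; field.
have -> : odd_angle n.+1 (2 ^ n + 2 ^ n - k.+1) = pi / 2 - odd_angle n.+1 k.
  rewrite /odd_angle.
  have -> : (2 ^ n + 2 ^ n - k.+1).*2.+1 = (2 ^ n.+2 - k.*2.+1)%N.
    by rewrite !expnS; lia.
  rewrite natrB; last by rewrite !expnS; lia.
  by rewrite natrX [2 ^+ n.+3]exprS; move: (2 ^+ n.+2) (pow2_neq0 n.+2) => t t0; field.
have kb' : 0 < odd_angle n.+1 k < pi / 2.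
  by apply: odd_angle_bounds; rewrite expnS; lia.
apply: csc2_double; rewrite gt_eqF //; first exact: sin_gt0_pihalf.
by apply: cos_gt0_pihalf; lra.
Qed.

(** * Sums over odd squares and the value of zeta(2) *)

Definition odd_sum n : R := \sum_(0 <= k < n) ((k.*2.+1)%:R ^+ 2)^-1.

(** After rescaling, the sum is that of 1/x^2 over the odd angles, which [csc2_bounds] compares with
    the cosecant sum 2 * 4^n. The lower bound loses 1 for each of the 2^n angles, a relative error
    of 2^-n / 2, relaxed here to 2^-n. *)
Lemma odd_sum_bounds n :
  pi ^+ 2 / 8 * (1 - 2^-1 ^+ n) <= odd_sum (2 ^ n) <= pi ^+ 2 / 8.
Proof.
have pi0 := pi_gt0 R.
have pow4 : 4 ^+ n = (2 ^+ n) ^+ 2 :> R.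
  by rewrite -exprM mulnC exprM; congr (_ ^+ n); ring.
have E : odd_sum (2 ^ n) =
    pi ^+ 2 / (16 * 4 ^+ n) * \sum_(0 <= k < 2 ^ n) (odd_angle n k ^+ 2)^-1.
  rewrite /odd_sum mulr_sumr; apply: eq_bigr => k _.
  rewrite /odd_angle (_ : 16 * 4 ^+ n = (2 ^+ n.+2) ^+ 2 :> R); last first.
    by rewrite pow4 !(exprS _ n.+1) (exprS _ n); move: (2 ^+ n) => t; ring.
  have : k.*2.+1%:R != 0 :> R by rewrite pnatr_eq0.
  move: (2 ^+ n.+2) (pow2_neq0 n.+2) pi (lt0r_neq0 pi0) (k.*2.+1%:R) => t t0 p p0 q q0.
  by field; rewrite t0 p0 q0.
have F c : (pi ^+ 2 / (16 * 4 ^+ n)) * (2 * 4 ^+ n * c) = pi ^+ 2 / 8 * c :> R.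
  by rewrite pow4; move: (2 ^+ n) (pow2_neq0 n) => t t0; field.
have D0 : 0 <= pi ^+ 2 / (16 * 4 ^+ n) :> R.
  by rewrite divr_ge0 ?sqr_ge0 // mulr_ge0 // exprn_ge0.
have S : 2^-1 ^+ n = (2 ^ n)%:R / 4 ^+ n :> R.
  by rewrite pow4 exprVn natrX; move: (2 ^+ n) (pow2_neq0 n) => t t0; field.
rewrite E; apply/andP; split; last first.
  rewrite -[leRHS]mulr1 -F ler_wpM2l // mulr1 -sum_csc2_odd_angle !big_nat.
  apply: ler_sum => k /andP[_ kn].
  by have /csc2_bounds/andP[] := odd_angle_bounds kn.
rewrite -F ler_wpM2l //.
apply: (@le_trans _ _ (\sum_(0 <= k < 2 ^ n) (csc2 (odd_angle n k) - 1))).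
  rewrite sumrB sum_csc2_odd_angle sumr_const_nat subn0 mulrBr mulr1 lerD2l lerN2.
  rewrite S (_ : 2 * 4 ^+ n * _ = 2 * (2 ^ n)%:R); first by rewrite ler_peMl // ler1n.
  by rewrite natrX pow4; move: (2 ^+ n) (pow2_neq0 n) => t t0; field.
rewrite !big_nat; apply: ler_sum => k /andP[_ kn].
by have /csc2_bounds/andP[] := odd_angle_bounds kn.
Qed.

Definition zeta2_sum n : R := \sum_(0 <= k < n) (k.+1%:R ^+ 2)^-1.

Lemma zeta2_sum_double n : zeta2_sum n.*2 = odd_sum n + zeta2_sum n / 4.
Proof.
elim: n => [|n IH]; first by rewrite /zeta2_sum /odd_sum !big_geq // mul0r addr0.
rewrite doubleS /zeta2_sum /odd_sum !big_nat_recr //= -!/(zeta2_sum _) -/(odd_sum _) IH.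
rewrite (_ : n.*2.+2%:R = 2 * n.+1%:R :> R); last by rewrite -natrM; congr _%:R; lia.
have : n.*2.+1%:R != 0 :> R by rewrite pnatr_eq0.
have : n.+1%:R != 0 :> R by rewrite pnatr_eq0.
move: (n.+1%:R) (n.*2.+1%:R) => a b a0 b0.
by field; rewrite a0 b0.
Qed.

(** Telescoping: 1/(n+2)^2 <= 1/(n+1) - 1/(n+2). This supplies the upper bound for monotone
    convergence. *)
Lemma zeta2_sum_le n : zeta2_sum n.+1 <= 2 - n.+1%:R^-1.
Proof.
elim: n => [|n IH]; first by rewrite /zeta2_sum big_nat1 expr1n invr1; lra.
rewrite /zeta2_sum big_nat_recr //= -/(zeta2_sum _).
have : (n.+2%:R ^+ 2)^-1 <= n.+1%:R^-1 - n.+2%:R^-1 :> R.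
  have -> : n.+1%:R^-1 - n.+2%:R^-1 = (n.+1%:R * n.+2%:R)^-1 :> R.
    have : n.+2%:R != 0 :> R by rewrite pnatr_eq0.
    have : n.+1%:R != 0 :> R by rewrite pnatr_eq0.
    by rewrite -(natr1 n.+1); move: (n.+1%:R) => a a0 a1; field; rewrite a0 a1.
  by rewrite lef_pV2 ?posrE ?mulr_gt0 ?exprn_gt0 // expr2 ler_pM2r // ler_nat.
by move=> H; apply: le_trans (lerD IH H) _; rewrite addrA subrK.
Qed.

(** Once a limit l is known to exist, the subsequence of powers of 2 determines it: separating odd
    and even squares gives l - l/4 = pi^2/8. *)
Lemma cvg_zeta2_sum : zeta2_sum @ \oo --> (pi ^+ 2 / 6 : R).
Proof.
have [l zl] : exists l : R, zeta2_sum @ \oo --> l.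
  apply/cvg_ex/nondecreasing_is_cvgn.
    apply/nondecreasing_seqP => n.
    by rewrite /zeta2_sum big_nat_recr //= lerDl invr_ge0 sqr_ge0.
  exists 2 => _ [n _ <-]; case: n => [|n]; first by rewrite /zeta2_sum big_geq.
  by apply: le_trans (zeta2_sum_le n) _; rewrite gerBl invr_ge0.
have pow_oo : (fun n => 2 ^ n)%N @ \oo --> \oo.
  by apply/cvgnyPge => m; exists m => // n /= mn; apply: leq_trans mn (ltnW (ltn_expl _ _)).
have zl1 : (fun n => zeta2_sum (2 ^ n)) @ \oo --> l by exact: cvg_comp pow_oo zl.
have zl2 : (fun n => zeta2_sum (2 ^ n).*2) @ \oo --> l.
  rewrite (_ : (fun n => _) = (fun n => zeta2_sum (2 ^ n.+1))).
    by rewrite (cvg_shiftS (fun n => zeta2_sum (2 ^ n))).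
  by apply/funext => n; rewrite expnS mul2n.
have ol : (fun n => odd_sum (2 ^ n)) @ \oo --> l - l / 4.
  rewrite (_ : (fun n => _) = (fun n => zeta2_sum (2 ^ n).*2 - zeta2_sum (2 ^ n) / 4)).
    by apply: cvgB => //; apply: cvgM => //; exact: cvg_cst.
  by apply/funext => n; rewrite zeta2_sum_double addrK.
have op : (fun n => odd_sum (2 ^ n)) @ \oo --> (pi ^+ 2 / 8 : R).
  apply: (@squeeze_cvgr _ _ _ _ (fun n => pi ^+ 2 / 8 * (1 - 2^-1 ^+ n)) (fun=> pi ^+ 2 / 8)).
  - by apply: nearW => n; exact: odd_sum_bounds.
  - rewrite -[X in _ --> X]mulr1; apply: cvgM; first exact: cvg_cst.
    rewrite -[X in _ --> X]subr0; apply: cvgB; first exact: cvg_cst.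
    by apply: cvg_expr; rewrite ger0_norm ?invr_ge0 // invf_lt1 // ltr1n.
  - exact: cvg_cst.
have lE : l - l / 4 = pi ^+ 2 / 8 by apply: cvg_unique ol op; exact: norm_hausdorff.
by rewrite (_ : _ / 6 = l) //; lra.
Qed.

End Basel.

(** * Cofactors and inner products *)

Section Hardy.
Context {R : realType}.
Implicit Types (P Q : {poly {poly R}}) (c : R) (i j m n : nat).

(** * Bilinearity and symmetry of the inner product *)

Lemma sum_ord_widen {V : nmodType} (F : nat -> V) {m n} : (m <= n)%N ->
  (forall k, (m <= k)%N -> F k = 0) -> \sum_(k < m) F k = \sum_(k < n) F k.
Proof.
move=> mn F0; rewrite (big_ord_widen n F mn) big_mkcond.
by apply: eq_bigr => k _; case: ltnP => // /F0 ->.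
Qed.

Lemma bisize_bounded P :
  exists M, forall m, (M <= m)%N -> (size P <= m)%N /\ forall b, (size (P`_b)%R <= m)%N.
Proof.
exists (maxn (size P) (\max_(b < size P) size (P`_b)%R)) => m.
rewrite geq_max => /andP[sP /bigmax_leqP sPb]; split=> // b.
have [bP|Pb] := ltnP b (size P); first exact: (sPb (Ordinal bP)).
by rewrite nth_default // size_poly0.
Qed.

(** The ranges in [h2inner] depend on its first argument only. A square box, chosen independently of
    [Q], can be enlarged to serve both arguments, which yields symmetry. *)
Lemma h2inner_wide P : exists M, forall m, (M <= m)%N -> forall Q,
  h2inner P Q = \sum_(b < m) \sum_(a < m) P`_b`_a * Q`_b`_a.
Proof.
have [M HM] := bisize_bounded P; exists M => m /HM[sP sPb] Q.
rewrite /h2inner -(sum_ord_widen (fun b => \sum_(a < m) P`_b`_a * Q`_b`_a) sP).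
  apply: eq_bigr => b _; apply: (sum_ord_widen (fun a => P`_b`_a * Q`_b`_a)) => // a aP.
  by rewrite nth_default ?mul0r.
by move=> b bP; rewrite big1 // => a _; rewrite [P`_b]nth_default // coef0 mul0r.
Qed.

Lemma h2innerC P Q : h2inner P Q = h2inner Q P.
Proof.
have [M HM] := h2inner_wide P; have [N HN] := h2inner_wide Q.
rewrite (HM (maxn M N)) ?leq_maxl // (HN (maxn M N)) ?leq_maxr //.
by apply: eq_bigr => b _; apply: eq_bigr => a _; rewrite mulrC.
Qed.

Lemma h2innerDr P Q1 Q2 : h2inner P (Q1 + Q2) = h2inner P Q1 + h2inner P Q2.
Proof.
rewrite /h2inner -big_split; apply: eq_bigr => b _.
by rewrite -big_split; apply: eq_bigr => a _ /=; rewrite !coefD mulrDr.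
Qed.

Lemma h2innerZr P c Q : h2inner P (cstP c * Q) = c * h2inner P Q.
Proof.
rewrite /h2inner mulr_sumr; apply: eq_bigr => b _.
by rewrite mulr_sumr; apply: eq_bigr => a _; rewrite !coefCM mulrCA.
Qed.

Lemma h2inner0r P : h2inner P 0 = 0.
Proof. by rewrite /h2inner big1 // => b _; rewrite big1 // => a _; rewrite !coef0 mulr0. Qed.

Lemma h2inner_sumr P (I : Type) (r : seq I) (F : I -> {poly {poly R}}) :
  h2inner P (\sum_(i <- r) F i) = \sum_(i <- r) h2inner P (F i).
Proof. exact: (big_morph _ (h2innerDr P) (h2inner0r P)). Qed.

Lemma h2innerDl P1 P2 Q : h2inner (P1 + P2) Q = h2inner P1 Q + h2inner P2 Q.
Proof. by rewrite h2innerC h2innerDr !(h2innerC Q). Qed.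

Lemma h2innerZl c P Q : h2inner (cstP c * P) Q = c * h2inner P Q.
Proof. by rewrite h2innerC h2innerZr (h2innerC Q). Qed.

Lemma h2inner_suml Q (I : Type) (r : seq I) (F : I -> {poly {poly R}}) :
  h2inner (\sum_(i <- r) F i) Q = \sum_(i <- r) h2inner (F i) Q.
Proof. by rewrite h2innerC h2inner_sumr; apply: eq_bigr => i _; rewrite h2innerC. Qed.

(** * Monomials and the Gram matrix of the shifts of p *)

Lemma coef_monomial (a b c d : nat) :
  (zP R ^+ a * wP R ^+ b)`_d`_c = ((c == a) && (d == b))%:R.
Proof.
rewrite /zP /wP -polyC_exp coefCM coefXn mulr_natr coefMn coefXn.
by rewrite -mulrnA mulnb.
Qed.

Lemma h2inner_monomial a b Q : h2inner (zP R ^+ a * wP R ^+ b) Q = Q`_b`_a.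
Proof.
have [M HM] := h2inner_wide (zP R ^+ a * wP R ^+ b).
set m := maxn M (maxn a b).+1.
have am : (a < m)%N by rewrite /m; lia.
have bm : (b < m)%N by rewrite /m; lia.
rewrite (HM m) ?leq_maxl // (bigD1 (Ordinal bm)) //= (bigD1 (Ordinal am)) //=.
rewrite coef_monomial !eqxx mul1r big1 ?addr0 => [|c ca]; last first.
  by rewrite coef_monomial -val_eqE /= in ca *; rewrite (negbTE ca) mul0r.
rewrite big1 ?addr0 // => d db; rewrite big1 // => c _.
by rewrite coef_monomial -val_eqE /= in db *; rewrite (negbTE db) andbF mul0r.
Qed.

(** The zeros [+ 0] are kept so that every term has exponents [i + s] and [b + s'] with s + s' = 2,
    the shape that the comparison of monomials in [h2inner_pP] expects. *)
Lemma pP_monomial i b : pP R * zP R ^+ i * wP R ^+ b =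
  zP R ^+ (i + 2) * wP R ^+ (b + 0) + cstP (-2) * (zP R ^+ (i + 1) * wP R ^+ (b + 1))
  + zP R ^+ (i + 0) * wP R ^+ (b + 2).
Proof.
rewrite /pP /cstP !exprD !polyCN !polyC_natr.
by ring.
Qed.

(* The pentadiagonal Toeplitz matrix with symbol |1 - t|^4, extended to all indices. *)
Definition toep i j : R :=
  6 * (i == j)%:R - 4 * (i == j.+1)%:R - 4 * (j == i.+1)%:R
  + (i == j.+2)%:R + (j == i.+2)%:R.

Lemma toepC i j : toep i j = toep j i.
Proof. by rewrite /toep (eq_sym i j); ring. Qed.

Lemma toep_addr k i j : toep (i + k) (j + k) = toep i j.
Proof. by rewrite /toep -!addSn !eqn_add2r. Qed.

Lemma h2inner_pP (i b j c : nat) : (i + b = j + c)%N ->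
  h2inner (pP R * zP R ^+ i * wP R ^+ b) (pP R * zP R ^+ j * wP R ^+ c) = toep i j.
Proof.
move=> ibjc; rewrite !pP_monomial !h2innerDl !h2innerDr !h2innerZl !h2innerZr.
rewrite !h2inner_monomial !coef_monomial.
(* Both sides are homogeneous of the same degree, so two of their monomials agree as soon as their
   z-exponents do. *)
have E s t s' t' : (s + s' = 2)%N -> (t + t' = 2)%N ->
    ((i + s == j + t) && (b + s' == c + t'))%N = (i + s == j + t)%N.
  by move=> ? ?; apply/idP/idP; lia.
rewrite !E // /toep !addn0 !addn1 !addn2 !eqSS.
rewrite (eq_sym j i.+1) (eq_sym j i.+2); ring.
Qed.

Lemma toep_dist i j : toep 0 (maxn i j - minn i j) = toep i j.
Proof.
wlog ij : i j / (i <= j)%N => [H|].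
  by case/orP: (leq_total i j) => [/H//|ji]; rewrite maxnC minnC (toepC i) H.
by rewrite -(toep_addr i 0 _) add0n (maxn_idPr ij) (minn_idPl ij) subnK.
Qed.

Lemma AmatE n : Amat R n = \matrix_(i, j) toep i j.
Proof.
apply/matrixP => i j; rewrite !mxE -toep_dist.
set d := (_ - _)%N.
rewrite -[pP R * wP R ^+ d]mulr1 -(expr0 (zP R)) mulrAC -[pP R * zP R ^+ d]mulr1 -(expr0 (wP R)).
by rewrite h2inner_pP ?addn0 ?add0n.
Qed.

(* Up to the factor D_{n+1}, the cofactors A^n_{0,j}: the cubic in j with zeros at -1, n+1, n+2,
   normalized so that its value at -2 is -1. *)
Definition toep_sol n j : R :=
  (j%:R + 1) * (n%:R + 1 - j%:R) * (n%:R + 2 - j%:R) / ((n%:R + 3) * (n%:R + 4)).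

(** The row index [m] is unrestricted, so rows beyond the matrix are covered too. The boolean
    factors cut off neighbours outside the range and cancel the default values of the truncated
    predecessors. *)
Lemma sum_toep n m (F : nat -> R) : \sum_(i < n) toep m i * F i =
  6 * ((m < n)%:R * F m) - 4 * (((0 < m <= n)%N)%:R * F m.-1) - 4 * ((m.+1 < n)%:R * F m.+1)
  + ((1 < m <= n.+1)%N)%:R * F m.-2 + (m.+2 < n)%:R * F m.+2.
Proof.
have D k : \sum_(i < n) (k == i :> nat)%:R * F i = (k < n)%:R * F k.
  have [kn|nk] := ltnP k n.
    rewrite (bigD1 (Ordinal kn)) //= eqxx big1 ?addr0 // => i ik.
    by rewrite -val_eqE /= in ik; rewrite eq_sym (negbTE ik) mul0r.
  by rewrite mul0r big1 // => i _; rewrite gtn_eqF ?mul0r // (leq_trans (ltn_ord i)).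
have E1 : \sum_(i < n) (m == i.+1)%:R * F i = ((0 < m <= n)%N)%:R * F m.-1.
  case: m => [|m] /=; first by rewrite mul0r big1 // => i _; rewrite mul0r.
  by rewrite -D; apply: eq_bigr => i _; rewrite eqSS.
have E2 : \sum_(i < n) (m == i.+2)%:R * F i = ((1 < m <= n.+1)%N)%:R * F m.-2.
  case: m {E1} => [|[|m]] /=; try by rewrite mul0r big1 // => i _; rewrite mul0r.
  by rewrite ltnS -D; apply: eq_bigr => i _; rewrite !eqSS.
rewrite -E1 -E2 -!D !mulr_sumr -!sumrN -!big_split /=; apply: eq_bigr => i _.
by rewrite /toep (eq_sym (i : nat) m.+1) (eq_sym (i : nat) m.+2); ring.
Qed.

(** Interior rows are fourth differences of a cubic. On the left, row 1 lacks only the zero at -1,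
    while row 0 also lacks the value -1 at -2 and so gives 1. *)
Lemma sum_toep_sol n m : (m <= n)%N ->
  \sum_(i < n.+1) toep m i * toep_sol n i = (m == 0)%:R.
Proof.
move=> mn.
have n3 : n%:R + 3 != 0 :> R by rewrite -natrD pnatr_eq0 addnS.
have n4 : n%:R + 4 != 0 :> R by rewrite -natrD pnatr_eq0 addnS.
have E1 : (m.+1 < n.+1)%:R * toep_sol n m.+1 = toep_sol n m.+1.
  case: ltnP => [|nm]; rewrite ?mul1r ?mul0r //.
  have -> : m = n by lia.
  by rewrite /toep_sol -natr1; field; rewrite n3 n4.
have E2 : (m.+2 < n.+1)%:R * toep_sol n m.+2 = toep_sol n m.+2.
  case: ltnP => [|nm]; rewrite ?mul1r ?mul0r //.
  have [->|->] : n = m \/ n = m.+1 by lia.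
    by rewrite /toep_sol -(natr1 m.+1) -natr1 (_ : m%:R + 2 - _ = 0); [rewrite mulr0 mul0r|ring].
  by rewrite /toep_sol -(natr1 m.+1) -natr1 (_ : m%:R + 1 + 1 - _ = 0); [rewrite mulr0 !mul0r|ring].
have E3 : (0 < m <= n.+1)%N = (0 < m)%N by lia.
have E4 : (1 < m <= n.+2)%N = (1 < m)%N by lia.
rewrite sum_toep E1 E2 E3 E4 ltnS mn.
case: m mn {E1 E2 E3 E4} => [|[|m]] mn /=.
- by rewrite /toep_sol; field; rewrite n3 n4.
- by rewrite /toep_sol; field; rewrite n3 n4.
rewrite /toep_sol -(natr1 m.+3) -(natr1 m.+2) -(natr1 m.+1) -natr1.
by field; rewrite n3 n4.
Qed.

(** The full fourth difference is 0 and the cubic vanishes at n+1 and n+2, so the truncated row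
    equals minus its value at n+3. *)
Lemma sum_toep_sol1 n : \sum_(i < n.+1) toep n.+1 i * toep_sol n i = - 2 / (n%:R + 3).
Proof.
have n3 : n%:R + 3 != 0 :> R by rewrite -natrD pnatr_eq0 addnS.
have n4 : n%:R + 4 != 0 :> R by rewrite -natrD pnatr_eq0 addnS.
have E1 : (n.+2 < n.+1)%N = false by lia.
have E2 : (n.+3 < n.+1)%N = false by lia.
have E3 : (1 < n.+1 <= n.+2)%N = (0 < n)%N by lia.
rewrite sum_toep ltnn E1 E2 E3 leqnn /=.
case: n n3 n4 {E1 E2 E3} => [|n] n3 n4 /=; rewrite /toep_sol -?natr1; field => //.
by rewrite !natr1 n3 n4.
Qed.

(** Only the column n meets this row, with coefficient 1, leaving the value of the cubic at n. *)
Lemma sum_toep_sol2 n : \sum_(i < n.+1) toep n.+2 i * toep_sol n i =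
  2 * (n%:R + 1) / ((n%:R + 3) * (n%:R + 4)).
Proof.
have n3 : n%:R + 3 != 0 :> R by rewrite -natrD pnatr_eq0 addnS.
have n4 : n%:R + 4 != 0 :> R by rewrite -natrD pnatr_eq0 addnS.
have E1 : (n.+2 < n.+1)%N = false by lia.
have E2 : (n.+3 < n.+1)%N = false by lia.
have E3 : (n.+4 < n.+1)%N = false by lia.
rewrite sum_toep E1 E2 E3 /= ltnn leqnn mulr0n mulr1n !mul0r /toep_sol.
by field; rewrite n3 n4.
Qed.

(** * Cofactors and determinants of the Toeplitz matrices *)

Lemma Amat_sol n : Amat R n *m (\col_j toep_sol n j) = delta_mx ord0 ord0.
Proof.
apply/matrixP => i k; rewrite AmatE !mxE ord1 eqxx andbT -val_eqE /=.
under eq_bigr => j _ do rewrite !mxE.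
by rewrite sum_toep_sol // -ltnS.
Qed.

Lemma Amat_sol_rev n : Amat R n *m (\col_j toep_sol n (n - j)) = delta_mx ord_max ord0.
Proof.
apply/matrixP => i k; rewrite AmatE !mxE ord1 eqxx andbT -val_eqE /=.
have i_n : (i <= n)%N by rewrite -ltnS.
under eq_bigr => j _ do rewrite !mxE.
rewrite (reindex_inj rev_ord_inj) /=.
transitivity (\sum_(j < n.+1) toep (n - i)%N j * toep_sol n j).
  apply: eq_bigr => j _; have jn : (j <= n)%N by rewrite -ltnS.
  rewrite subSS subKn //; congr (_ * _).
  (* A symmetric Toeplitz matrix is unchanged when rows and columns are both reversed. *)
  by rewrite toepC -(toep_addr j (n - j)) -(toep_addr i (n - i)) !subnK // addnC.
by rewrite sum_toep_sol ?leq_subr // subn_eq0 eqn_leq i_n.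
Qed.

(** Multiplying A v = e_k by the adjugate, rather than by the inverse, does not presuppose a nonzero
    determinant; [Dn_gt0] can thus be deduced from the cofactors. *)
Lemma cofactor_of_col {n} {k : 'I_n.+1} (j : 'I_n.+1) {v : 'cV[R]_n.+1} :
  Amat R n *m v = delta_mx k ord0 -> cofactor (Amat R n) k j = \det (Amat R n) * v j ord0.
Proof.
move=> Av; have : \adj (Amat R n) *m (Amat R n *m v) = \det (Amat R n) *: v.
  by rewrite mulmxA mul_adj_mx mul_scalar_mx.
rewrite Av => /matrixP/(_ j ord0); rewrite !mxE => <-.
rewrite (bigD1 k) //= !mxE !eqxx mulr1 big1 ?addr0 // => l lk.
by rewrite !mxE (negbTE lk) mulr0.
Qed.

Lemma cofactor_first n (j : 'I_n.+1) : cofactor (Amat R n) ord0 j = Dn R n.+1 * toep_sol n j.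
Proof. by rewrite (cofactor_of_col _ (Amat_sol n)) mxE. Qed.

Lemma cofactor_last n (j : 'I_n.+1) :
  cofactor (Amat R n) ord_max j = Dn R n.+1 * toep_sol n (n - j).
Proof. by rewrite (cofactor_of_col _ (Amat_sol_rev n)) mxE. Qed.

(** Deleting the first row and column of A^n leaves A^(n-1), so D_n is its (0,0) cofactor. *)
Lemma Dn_rec n : Dn R n = Dn R n.+1 * toep_sol n 0.
Proof.
rewrite -(cofactor_first n ord0) /cofactor expr0 mul1r.
case: n => [|n] /=; first by rewrite det_mx00.
congr (\det _); rewrite !AmatE; apply/matrixP => i j; rewrite !mxE /= /bump /= !add1n.
by rewrite -[in RHS]addn1 -[j.+1]addn1 toep_addr.
Qed.

Lemma sol0_gt0 n : 0 < toep_sol n 0.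
Proof. by rewrite /toep_sol divr_gt0 // ?mulr_gt0 //; have := ler0n R n; lra. Qed.

Lemma Dn_gt0 n : 0 < Dn R n.
Proof.
elim: n => [|n IH]; first exact: ltr01.
by move: IH; rewrite Dn_rec pmulr_lgt0 // sol0_gt0.
Qed.

Lemma cstPM (a b : R) : cstP (a * b) = cstP a * cstP b.
Proof. by rewrite /cstP !polyCM. Qed.

(** Since D_(n+1) D_n = D_(n+1)^2 f_n(0), all determinants cancel. The arbitrary [v] serves both phi
    and psi. *)
Lemma cofactor_normalized n (v : nat -> R) :
  cstP (Num.sqrt (Dn R n.+1 * Dn R n))^-1 *
    \sum_(j < n.+1) cstP (Dn R n.+1 * v j) * (pP R * zP R ^+ j * wP R ^+ (n - j))
  = cstP (Num.sqrt (toep_sol n 0))^-1 *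
    \sum_(j < n.+1) cstP (v j) * (pP R * zP R ^+ j * wP R ^+ (n - j)).
Proof.
have D0 := Dn_gt0 n.+1; have s0 := sol0_gt0 n.
under eq_bigr => j _ do rewrite cstPM -mulrA.
rewrite -mulr_sumr mulrA -cstPM (Dn_rec n) mulrA -expr2 sqrtrM ?sqr_ge0 //.
by rewrite sqrtr_sqr gtr0_norm // invfM mulrAC mulVf ?mul1r ?gt_eqF.
Qed.

(** As f_0(0) = 1/6 and the norm of p is sqrt 6, this puts the separately defined case n = 0 into
    the form used for n >= 1. *)
Lemma h2norm_pP : (h2norm (pP R))^-1 = (Num.sqrt (toep_sol 0 0))^-1 * toep_sol 0 0.
Proof.
have pE : pP R = pP R * zP R ^+ 0 * wP R ^+ 0 by rewrite !expr0 !mulr1.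
rewrite /h2norm pE h2inner_pP // (_ : toep 0 0 = 6); last by rewrite /toep /=; ring.
have -> : toep_sol 0 0 = 6^-1 by rewrite /toep_sol; field.
rewrite sqrtrV // invrK -{3}[6](@sqr_sqrtr R) //.
by have : Num.sqrt 6 != 0 :> R; [rewrite gt_eqF // sqrtr_gt0|move=> t0; field].
Qed.

(** * The basis vectors, their pairing and the partial sums *)

Lemma phiE n : phi R n = cstP (Num.sqrt (toep_sol n 0))^-1 *
  \sum_(j < n.+1) cstP (toep_sol n j) * (pP R * zP R ^+ j * wP R ^+ (n - j)).
Proof.
case: n => [|n]; first by rewrite /phi big_ord1 h2norm_pP cstPM !expr0 !mulr1 mulrA.
rewrite -cofactor_normalized; congr (_ * _).
by apply: eq_bigr => j _; rewrite cofactor_first.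
Qed.

Lemma psiE n : psi R n = cstP (Num.sqrt (toep_sol n 0))^-1 *
  \sum_(j < n.+1) cstP (toep_sol n (n - j)) * (pP R * zP R ^+ j * wP R ^+ (n - j)).
Proof.
case: n => [|n]; first by rewrite /psi big_ord1 h2norm_pP cstPM !expr0 !mulr1 mulrA.
rewrite -(cofactor_normalized _ (fun j => toep_sol n.+1 (n.+1 - j))); congr (_ * _).
by apply: eq_bigr => j _; rewrite cofactor_last.
Qed.

Lemma sum_toep_sol_sol n :
  \sum_(j < n.+1) toep_sol n j * (\sum_(i < n.+1) toep (n - j).+2 i * toep_sol n i)
  = toep_sol n 0 * (2 * (n%:R + 1) / ((n%:R + 3) * (n%:R + 4))) - toep_sol n 1 * (2 / (n%:R + 3)).
Proof.
rewrite big_ord_recl subn0 sum_toep_sol2; congr (_ + _).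
(* For n = 0 there is no term j = 1, in agreement with f_0(1) = 0. *)
case: n => [|n]; first by rewrite big_ord0 /toep_sol mulr1n add0r subrr mulr0 !mul0r oppr0.
rewrite big_ord_recl /= [X in _ + X]big1 ?addr0 => [|j _].
  by rewrite subSS subn0 sum_toep_sol1 mulNr mulrN.
have jn := ltn_ord j.
by rewrite /bump /= !add1n !subSS sum_toep_sol ?mulr0 //; lia.
Qed.

Lemma h2inner_phi_psi n :
  h2inner (wP R ^+ 2 * phi R n) (zP R ^+ 2 * psi R n) =
  - 2 * (n%:R ^+ 2 + 5 * n%:R - 2) / ((n%:R + 2) * (n%:R + 3) * (n%:R + 4)).
Proof.
rewrite phiE psiE !(mulrCA (_ ^+ 2)) h2innerZl h2innerZr [wP R ^+ 2 * _]mulr_sumr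
  [zP R ^+ 2 * _]mulr_sumr h2inner_suml.
under eq_bigr => i _.
  rewrite h2inner_sumr.
  under eq_bigr => j _.
    rewrite [wP R ^+ 2 * _]mulrCA [zP R ^+ 2 * _]mulrCA h2innerZl h2innerZr.
    have -> : wP R ^+ 2 * (pP R * zP R ^+ i * wP R ^+ (n - i)) =
      pP R * zP R ^+ i * wP R ^+ (n - i).+2 by rewrite !exprS; ring.
    have -> : zP R ^+ 2 * (pP R * zP R ^+ j * wP R ^+ (n - j)) =
      pP R * zP R ^+ j.+2 * wP R ^+ (n - j) by rewrite !exprS; ring.
    rewrite h2inner_pP; last by have := ltn_ord i; have := ltn_ord j; lia.
    over.
  over.
(* Reversing [j] turns the coefficient f_n(n - j) of psi into f_n(j) and moves its z-exponent to n -
   j + 2, the row index in [sum_toep_sol_sol]. *)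
rewrite exchange_big /= (reindex_inj rev_ord_inj) /=.
rewrite (eq_bigr (fun j : 'I_n.+1 => toep_sol n j *
    (\sum_(i < n.+1) toep (n - j).+2 i * toep_sol n i))) => [|j _]; last first.
  have jn : (j <= n)%N by rewrite -ltnS.
  rewrite mulr_sumr subSS subKn //; apply: eq_bigr => i _.
  by rewrite toepC; ring.
have s0 := sol0_gt0 n.
rewrite sum_toep_sol_sol mulrA -invfM -expr2 sqr_sqrtr ?ltW //.
have n1 : n%:R + 1 != 0 :> R by rewrite natr1 pnatr_eq0.
have n2 : n%:R + 2 != 0 :> R by rewrite -natrD pnatr_eq0 addnS.
have n3 : n%:R + 3 != 0 :> R by rewrite -natrD pnatr_eq0 addnS.
have n4 : n%:R + 4 != 0 :> R by rewrite -natrD pnatr_eq0 addnS.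
by rewrite /toep_sol; field; rewrite n1 n2 n3 n4.
Qed.

(** The double poles of the summand at -2, -3, -4 have coefficients 16, 64, 9 (times 4). The simple
    poles -52, 16, 36 sum to 0 and telescope into the two reciprocals; 585 is the bracketed
    expression at n = 0, times 4. *)
Lemma series_Sigma2 n : series (Sigma_term R 2) n =
  4 * (16 * zeta2_sum n.+1 + 64 * zeta2_sum n.+2 + 9 * zeta2_sum n.+3
       + 52 * n.+2%:R^-1 + 36 * n.+3%:R^-1) - 585.
Proof.
rewrite /series /=; elim: n => [|n IH].
  by rewrite big_geq // /zeta2_sum !big_nat_recr //= big_geq //; field.
rewrite big_nat_recr //= IH /Sigma_term h2inner_phi_psi real_normK ?num_real //.
rewrite {IH} /zeta2_sum !big_nat_recr //=.
set S := \sum_(0 <= k < n) _.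
have n1 : n%:R + 1 != 0 :> R by rewrite natr1 pnatr_eq0.
have n2 : n%:R + 2 != 0 :> R by rewrite -natrD pnatr_eq0 addnS.
have n3 : n%:R + 3 != 0 :> R by rewrite -natrD pnatr_eq0 addnS.
have n4 : n%:R + 4 != 0 :> R by rewrite -natrD pnatr_eq0 addnS.
have -> : n.+1%:R = n%:R + 1 :> R by rewrite natr1.
have -> : n.+2%:R = n%:R + 2 :> R by rewrite -natrD addn2.
have -> : n.+3%:R = n%:R + 3 :> R by rewrite -natrD addn3.
have -> : n.+4%:R = n%:R + 4 :> R by rewrite -natrD addn4.
by field; rewrite n1 n2 n3 n4.
Qed.

End Hardy.

Theorem theorem3p3 (R : realType) :
  series (Sigma_term R 2) @ \oo --> (178%:R / 3%:R * pi ^+ 2 - 585%:R : R).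
Proof.
have zk k : (fun n => zeta2_sum (n + k)) @ \oo --> (pi ^+ 2 / 6 : R).
  by rewrite (cvg_shiftn k zeta2_sum); exact: cvg_zeta2_sum.
have hk k : (fun n => (n + k).+1%:R^-1) @ \oo --> (0 : R).
  by rewrite (cvg_shiftn k (fun n => n.+1%:R^-1 : R)); exact: cvg_harmonic.
rewrite (_ : series _ = fun n =>
  4 * (16 * zeta2_sum (n + 1) + 64 * zeta2_sum (n + 2) + 9 * zeta2_sum (n + 3)
       + 52 * (n + 1).+1%:R^-1 + 36 * (n + 2).+1%:R^-1) - 585); last first.
  by apply/funext => n; rewrite series_Sigma2 addn1 addn2 addn3.
(* The limit is written in the shape of the sequence, to pass to the limit termwise: 4 (16 + 64 + 9)
   / 6 = 178/3. *)
rewrite (_ : _ - 585%:R = 4 * (16 * (pi ^+ 2 / 6) + 64 * (pi ^+ 2 / 6) + 9 * (pi ^+ 2 / 6)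
  + 52 * 0 + 36 * 0) - 585); last by field.
apply: cvgB; last exact: cvg_cst.
apply: cvgM; first exact: cvg_cst.
by do 4 ?[apply: cvgD]; (apply: cvgM; first exact: cvg_cst) => //.
Qed.
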